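(* Let $\omega\in[0,1]\setminus\mathbb{Q}$, $\mathbb{I}=[-2,2]$ and $\Omega=\mathbb{S}^1\times\mathbb{I}$. There exists a map $T\in\mathcal{S}(\Omega)$, $T(\theta,x)=(R_\omega(\theta),f(\theta,x))$, with $f(\theta,\cdot)$ non-increasing for every $\theta\in\mathbb{S}^1$, such that $T$ permutes the upper and lower circles of $\Omega$ (that is, $f(\theta,2)=-2$ and $f(\theta,-2)=2$ for every $\theta\in\mathbb{S}^1$; thus $T$ has a periodic orbit of period two of curves), and there exists a connected pseudo-curve $\mathsf{A}\subset\Omega$ which does not contain any arc of a curve such that $T(\mathsf{A})=\mathsf{A}$, and there does not exist any $T$-invariant curve.
   Context: $\mathbb{S}^1=\mathbb{R}/\mathbb{Z}$ and $R_\omega(\theta)=\theta+\omega \pmod 1$. $\mathcal{S}(\Omega)$ is the class of all maps $F:\Omega\to\Omega$ of the form $F(\theta,x)=(R_\omega(\theta),\zeta(\theta,x))$ with $\zeta:\mathbb{S}^1\times\mathbb{I}\to\mathbb{I}$ continuous (in both variables jointly). The upper and lower circles of $\Omega$ are $\mathbb{S}^1\times\{2\}$ and $\mathbb{S}^1\times\{-2\}$. A subset of $\mathbb{S}^1$ is residual if it contains the intersection of a countable family of open dense subsets of $\mathbb{S}^1$. A pseudo-curve is a set of the form $\overline{\mathrm{Graph}(\varphi)}$ (closure in $\Omega$), where $G\subset\mathbb{S}^1$ is residual, $\varphi:G\to\mathbb{I}$ is continuous, and $\mathrm{Graph}(\varphi)=\{(\theta,\varphi(\theta)):\theta\in G\}$.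 A curve is the graph of a continuous map from $\mathbb{S}^1$ to $\mathbb{I}$; an arc of a curve is the graph of a continuous function from a (non-degenerate) arc of $\mathbb{S}^1$ to $\mathbb{I}$. A set $A\subset\Omega$ is $F$-invariant if $F(A)\subset A$; a $T$-invariant curve is a curve that is a $T$-invariant set. *)

(* Defs.v *)
From HB Require Import structures.
From mathcomp Require Import all_boot all_order all_algebra.
From mathcomp Require Import all_classical all_reals all_analysis.
From mathcomp Require Import generic_quotient borel_hierarchy.

Set Implicit Arguments.
Unset Strict Implicit.
Unset Printing Implicit Defensive.

Import Order.TTheory GRing.Theory Num.Theory.
Import numFieldNormedType.Exports.

Local Open Scope classical_set_scope.
Local Open Scope ring_scope.
Local Open Scope quotient_scope.

Definition int_congr (R : realType) (x y : R) : bool := x - y \is a Num.int.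

Lemma S1_rel_refl (R : realType) : reflexive (@int_congr R).
Proof. by move=> x; rewrite /int_congr subrr rpred0. Qed.

Lemma S1_rel_sym (R : realType) : symmetric (@int_congr R).
Proof. by move=> x y; rewrite /int_congr -opprB rpredN. Qed.

Lemma S1_rel_trans (R : realType) : transitive (@int_congr R).
Proof. by move=> y x z xy yz; rewrite /int_congr -(subrKA y) rpredD. Qed.

Canonical S1_rel (R : realType) :=
  EquivRel (@int_congr R) (@S1_rel_refl R) (@S1_rel_sym R) (@S1_rel_trans R).

Definition S1 (R : realType) : Type := quotient_topology {eq_quot (S1_rel R)}.

Definition S1_pi (R : realType) (x : R) : S1 R := \pi_(S1 R) x.

Lemma S1_pi_eq (R : realType) (x y : R) :
  S1_pi x = S1_pi y <-> x - y \is a Num.int.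
Proof.
by split=> [/(@eqquotP _ _ {eq_quot (S1_rel R)})|xy] //;
  apply/(@eqquotP _ _ {eq_quot (S1_rel R)}).
Qed.

(* Independent of the chosen representative of theta: see [rotationE]. *)
Definition rotation (R : realType) (omega : R) (theta : S1 R) : S1 R :=
  S1_pi (repr theta + omega).

Lemma rotationE (R : realType) (omega x : R) :
  rotation omega (S1_pi x) = S1_pi (x + omega).
Proof.
apply/S1_pi_eq; rewrite opprD addrACA subrr addr0; apply/S1_pi_eq.
exact: reprK.
Qed.

(* As [set_type]s, [II] carries the topology induced by R and [Omega] the
   corresponding product topology. *)
Definition II (R : realType) : Type := set_type `[(-2 : R), 2]%classic.

Definition II_val (R : realType) (x : II R) : R := \val x.

Lemma II_top_subproof (R : realType) :
  (2 : R) \in `[(-2 : R), 2]%classic.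
Proof. by rewrite mem_setE in_itv/= lexx andbT ge0_cp. Qed.

Lemma II_bot_subproof (R : realType) :
  (-2 : R) \in `[(-2 : R), 2]%classic.
Proof. by rewrite mem_setE in_itv/= lexx ge0_cp. Qed.

Definition II_top (R : realType) : II R := exist _ 2 (II_top_subproof R).
Definition II_bot (R : realType) : II R := exist _ (-2) (II_bot_subproof R).

Definition Omega (R : realType) : Type := (S1 R * II R)%type.

Definition S_class (R : realType) (omega : R) : set (Omega R -> Omega R) :=
  [set F | exists2 zeta : Omega R -> II R, continuous zeta &
     forall theta x, F (theta, x) = (rotation omega theta, zeta (theta, x))].

Definition graph_on (R : realType) (G : set (S1 R)) (phi : S1 R -> II R) :
  set (Omega R) := [set p | G p.1 /\ p.2 = phi p.1].

Definition upper_circle (R : realType) : set (Omega R) :=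
  [set p | p.2 = II_top R].
Definition lower_circle (R : realType) : set (Omega R) :=
  [set p | p.2 = II_bot R].

Definition residual (X : topologicalType) (G : set X) : Prop :=
  exists2 B : set X, Gdelta_dense B & B `<=` G.

Definition pseudo_curve (R : realType) (A : set (Omega R)) : Prop :=
  exists (G : set (S1 R)) (phi : S1 R -> II R),
    [/\ residual G, {within G, continuous phi} & A = closure (graph_on G phi)].

Definition curve (R : realType) (C : set (Omega R)) : Prop :=
  exists2 gamma : S1 R -> II R, continuous gamma & C = graph_on setT gamma.

(* Arcs are images of intervals of R with at least two points, whether or not
   they contain their endpoints. *)
Definition circle_arc (R : realType) (J : set (S1 R)) : Prop :=
  exists i : set R, [/\ is_interval i, exists x y, [/\ i x, i y & x < y]
    & J = @S1_pi R @` i].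

Definition arc_of_curve (R : realType) (C : set (Omega R)) : Prop :=
  exists (J : set (S1 R)) (psi : S1 R -> II R),
    [/\ circle_arc J, {within J, continuous psi} & C = graph_on J psi].

Definition invariant_set (R : realType) (F : Omega R -> Omega R)
  (A : set (Omega R)) : Prop := F @` A `<=` A.

Definition period_two_curves (R : realType) (F : Omega R -> Omega R)
    (C D : set (Omega R)) : Prop :=
  [/\ curve C, curve D, C <> D, F @` C = D & F @` D = C].

(* Main.v *)
(* Let [osc] be a 1-periodic function which is continuous off the integers, where it
   oscillates through all of [0, 1/2], and put
     phi(t) = \sum_(k >= 0) (-1/2)^k osc(t + k omega).
   It is continuous off the (dense) backward orbit of 0. The closure A of its graph
   consists of the points (t, \sum_k (-1/2)^k y_k) where every (t + k omega, y_k) lies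
   in the closure of the graph of [osc]: fibres are segments, so A is connected, and
   they are nondegenerate over a dense set, so A contains no arc. Since
   phi(t + omega) = 2 (osc(t) - phi(t)), the shift of the sequences (y_k) acts on A by
   x |-> 2 (osc(t) - x); truncating this decreasing map to a continuous band around
   phi(omega), which contains the fibres of A over t + omega and has width 0 at t = 0,
   makes it continuous. An invariant curve which meets A lies in A by density of
   orbits; one which does not leaves the connected set A on one side, but a decreasing
   map exchanges the two sides. *)
Require Import Defs.
From mathcomp Require Import all_boot all_order all_algebra.
From mathcomp Require Import all_classical all_reals all_analysis.
From mathcomp Require Import ring lra zify.

Set Implicit Arguments.
Unset Strict Implicit.
Unset Printing Implicit Defensive.

Import Order.TTheory GRing.Theory Num.Theory.
Import numFieldNormedType.Exports.

Local Open Scope classical_set_scope.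
Local Open Scope ring_scope.

(** * Distance to the nearest integer, and the oscillating function built from it *)

Section DistanceToIntegers.
Context {R : realType}.
Implicit Types x y z a b : R.

Definition dist_int x : R := `|x - (Num.floor (x + 2^-1))%:~R|.

Lemma dist_int_le_half x : dist_int x <= 2^-1.
Proof.
have /andP[h1] := floor_itv (x + 2^-1); rewrite intrD => h2; rewrite /dist_int.
by rewrite ler_norml; apply/andP; split; lra.
Qed.

Lemma dist_int_ge0 x : 0 <= dist_int x.
Proof. exact: normr_ge0. Qed.

Lemma dist_int_nearest x (m : int) : dist_int x <= `|x - m%:~R|.
Proof.
have hl := dist_int_le_half x; set k := Num.floor (x + 2^-1) in hl *.
have [->|mk] := eqVneq m k; first by [].
have h1 : 1 <= `|m%:~R - k%:~R : R|.
  by rewrite -intrB -intr_norm ler1z -gtz0_ge1 normr_gt0 subr_eq0.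
have := ler_distD x (m%:~R : R) k%:~R.
rewrite [`|m%:~R - x|]distrC -/(dist_int x).
by move: hl; rewrite /dist_int -/k => hl; lra.
Qed.

Lemma dist_int_attained x : exists m : int, dist_int x = `|x - m%:~R|.
Proof. by exists (Num.floor (x + 2^-1)). Qed.

Lemma dist_intD_int x (n : R) : n \is a Num.int -> dist_int (x + n) = dist_int x.
Proof.
move=> nint; rewrite /dist_int (addrAC x n 2^-1) floorDrz// intrD (floorK nint).
by congr `|_|; ring.
Qed.

Lemma dist_intN x : dist_int (- x) = dist_int x.
Proof.
wlog suff h : x / dist_int (- x) <= dist_int x.
  by apply/le_anti; rewrite h -{1}(opprK x) h.
have [m ->] := dist_int_attained x.
rewrite -normrN opprB addrC -[m%:~R]opprK -intrN; exact: dist_int_nearest.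
Qed.

Lemma dist_int_triangle x y : dist_int (x + y) <= dist_int x + dist_int y.
Proof.
have [m ->] := dist_int_attained x; have [n ->] := dist_int_attained y.
apply: le_trans (ler_normD _ _).
have -> : x - m%:~R + (y - n%:~R) = x + y - (m + n)%:~R by rewrite intrD; ring.
exact: dist_int_nearest.
Qed.

Lemma dist_int_le_norm x : dist_int x <= `|x|.
Proof. by have := dist_int_nearest x 0; rewrite subr0. Qed.

Lemma dist_int_dist x y : `|dist_int x - dist_int y| <= dist_int (x - y).
Proof.
have h1 := dist_int_triangle (x - y) y; have h2 := dist_int_triangle (y - x) x.
rewrite !subrK -?(opprB x y) ?dist_intN in h1 h2.
by rewrite ler_norml; apply/andP; split; lra.
Qed.

Lemma dist_int_lip x y : `|dist_int x - dist_int y| <= `|x - y|.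
Proof. exact: le_trans (dist_int_dist x y) (dist_int_le_norm _). Qed.

Lemma dist_int_eq0 x : (dist_int x == 0) = (x \is a Num.int).
Proof.
apply/idP/idP => [|xint].
  have [m ->] := dist_int_attained x; rewrite normr_eq0 subr_eq0 => /eqP ->.
  exact: intr_int.
rewrite -(add0r x) dist_intD_int// eq_le dist_int_ge0 andbT.
by rewrite (le_trans (dist_int_le_norm 0))// normr0.
Qed.

Lemma dist_int_id x : 0 <= x <= 2^-1 -> dist_int x = x.
Proof.
move=> /andP[x0 x1]; apply/le_anti/andP; split.
  by rewrite -[leRHS]ger0_norm// dist_int_le_norm.
have [m ->] := dist_int_attained x.
have [m0|m1] := leP m 0.
  have hm : (m%:~R : R) <= 0 by rewrite lerz0.
  by rewrite ger0_norm; lra.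
have hm : 1 <= (m%:~R : R) by rewrite ler1z -gtz0_ge1.
by rewrite ler0_norm; lra.
Qed.

Lemma continuous_dist_int : continuous (@dist_int).
Proof.
move=> x; apply/cvgrPdist_lt => e e0; near=> y.
apply: le_lt_trans (dist_int_lip _ _) _; near: y.
exact: cvgr_dist_lt.
Unshelve. all: by end_near. Qed.

(* Here [1 / 0 = 0], so [osc] vanishes on the integers. *)
Definition osc x : R := dist_int (dist_int x)^-1.

Lemma osc_bounds x : 0 <= osc x <= 2^-1.
Proof. by rewrite dist_int_ge0 dist_int_le_half. Qed.

Lemma oscD_int x (n : R) : n \is a Num.int -> osc (x + n) = osc x.
Proof. by move=> nint; rewrite /osc dist_intD_int. Qed.

(* At an integer [b] the denominator vanishes and the modulus is the junk value [0]. *)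
Definition osc_mod b d : R := Num.min 2^-1 (2 * dist_int d / dist_int b ^+ 2).

Lemma osc_mod_ge0 b d : 0 <= osc_mod b d.
Proof.
by rewrite le_min invr_ge0 ler0n/= divr_ge0 ?sqr_ge0// mulr_ge0// dist_int_ge0.
Qed.

Lemma osc_mod_le_half b d : osc_mod b d <= 2^-1.
Proof. by rewrite ge_min lexx. Qed.

Lemma osc_mod_int b d : d \is a Num.int -> osc_mod b d = 0.
Proof.
rewrite -dist_int_eq0 => /eqP d0.
by rewrite /osc_mod d0 mulr0 mul0r min_r// invr_ge0.
Qed.

(** The quotient is then at least [1 / dist_int b], hence at least 2, and the cap 1/2 wins. *)
Lemma osc_mod_far b d : b \isn't a Num.int -> dist_int b <= 2 * dist_int d ->
  osc_mod b d = 2^-1.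
Proof.
rewrite -dist_int_eq0 => b0 bd; apply/min_l.
have {}b0 : 0 < dist_int b by rewrite lt_def b0 dist_int_ge0.
have hb := dist_int_le_half b.
rewrite ler_pdivlMr ?exprn_gt0//; nra.
Qed.

(** For distant points only the range of [osc] matters. Otherwise [dist_int a] exceeds half of
    [dist_int b], and the two inverses differ by at most [2 / dist_int b ^+ 2] times the
    distance. *)
Lemma osc_diff a b : b \isn't a Num.int -> `|osc a - osc b| <= osc_mod b (a - b).
Proof.
move=> bn; have [ha1 ha2] := andP (osc_bounds a).
have [hb1 hb2] := andP (osc_bounds b).
have [bd|bd] := leP (dist_int b) (2 * dist_int (a - b)).
  by rewrite osc_mod_far// ler_norml; apply/andP; split; lra.
rewrite le_min; apply/andP; split; first by rewrite ler_norml; apply/andP; split; lra.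
have b0 : 0 < dist_int b by rewrite lt_def dist_int_eq0 bn dist_int_ge0.
have := dist_int_dist a b; rewrite ler_norml => /andP[h1 h2].
have a0 : 0 < dist_int a by lra.
apply: le_trans (dist_int_lip _ _) _.
have -> : (dist_int a)^-1 - (dist_int b)^-1 =
    (dist_int b - dist_int a) / (dist_int a * dist_int b).
  by field; rewrite !gt_eqF.
rewrite normrM normfV (ger0_norm (ltW (mulr_gt0 a0 b0))) distrC.
rewrite ler_pdivrMr ?mulr_gt0// -mulrA.
apply: le_trans (dist_int_dist a b) _.
rewrite [X in _ <= X]mulrAC mulrA -[leLHS]mul1r -[leRHS]mulrA mulrC [leRHS]mulrCA.
apply: ler_wpM2l; first exact: dist_int_ge0.
rewrite mulrA ler_pdivlMr ?exprn_gt0//.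
by nra.
Qed.

Lemma continuous_osc b : b \isn't a Num.int -> {for b, continuous osc}.
Proof.
rewrite -dist_int_eq0 => b0; apply: continuous_comp; last exact: continuous_dist_int.
by apply: continuousV => //; exact: continuous_dist_int.
Qed.

Lemma continuous_osc_mod b : continuous (osc_mod b).
Proof.
move=> d; apply: (continuous_min (f := fun=> 2^-1)
  (g := fun d => 2 * dist_int d / dist_int b ^+ 2)); first exact: cvg_cst.
by apply: cvgMr_tmp; apply: cvgMl_tmp; exact: continuous_dist_int.
Qed.

(** Points tending to 0 at which [osc] takes a prescribed value exactly. The shift by 2 keeps the
    inverse within [0, 1/2], where [dist_int] is the identity. *)
Lemma osc_attains r (n : nat) : 0 <= r <= 2^-1 -> osc (n.+2%:R + r)^-1 = r.
Proof.
move=> /andP[r0 r1].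
have n2 : (2 : R) <= n.+2%:R by rewrite ler_nat.
have hn : 2 <= n.+2%:R + r by lra.
have hpos : 0 < n.+2%:R + r by lra.
rewrite /osc (@dist_int_id (n.+2%:R + r)^-1).
  by rewrite invrK addrC dist_intD_int ?natr_int// dist_int_id//; lra.
by rewrite invr_ge0 (ltW hpos) lef_pV2 ?posrE.
Qed.

End DistanceToIntegers.

(** * Series weighted by the powers of a ratio of absolute value at most 1/2 *)

Section WeightedSums.
Context {R : realType}.
Implicit Types (c a b : R) (y z d : nat -> R).

(** Used with [c = - 2^-1] for the points of fibres and with [c = 2^-1] for bounds on their
    differences. *)
Definition wsum c y : R := limn (series (fun k => c ^+ k * y k)).

Lemma is_cvg_wsum_normed c y : `|c| <= 2^-1 -> (forall k, `|y k| <= 1) ->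
  cvgn [normed series (fun k => c ^+ k * y k)].
Proof.
move=> hc hy.
apply: (@series_le_cvg R _ (geometric 1 (2^-1 : R))) => [n|n|n|].
- exact: normr_ge0.
- by rewrite /= mul1r exprn_ge0// invr_ge0.
- rewrite /= mul1r normrM normrX -[leRHS]mulr1.
  by rewrite ler_pM// ?exprn_ge0// lerXn2r ?nnegrE// invr_ge0.
- by apply: is_cvg_geometric_series; rewrite ger0_norm ?invr_ge0//; lra.
Qed.

Lemma is_cvg_wsum c y : `|c| <= 2^-1 -> (forall k, `|y k| <= 1) ->
  cvgn (series (fun k => c ^+ k * y k)).
Proof. by move=> hc hy; apply: normed_cvg; exact: is_cvg_wsum_normed. Qed.

Lemma wsum_lin c a b y z : `|c| <= 2^-1 ->
    (forall k, `|y k| <= 1) -> (forall k, `|z k| <= 1) ->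
  wsum c (fun k => a * y k + b * z k) = a * wsum c y + b * wsum c z.
Proof.
move=> hc hy hz; have cy := is_cvg_wsum hc hy; have cz := is_cvg_wsum hc hz.
rewrite /wsum -[a * _]/(a *: _) -[b * _]/(b *: _) -!lim_seriesZ//.
rewrite -lim_seriesD; [|exact: is_cvg_seriesZ..].
by congr (limn (series _)); apply/funext => k; rewrite !fctE /GRing.scale/=; ring.
Qed.

Lemma wsum_rec c y : `|c| <= 2^-1 -> (forall k, `|y k| <= 1) ->
  wsum c y = y 0 + c * wsum c (fun k => y k.+1).
Proof.
move=> hc hy; rewrite /wsum.
have cS := is_cvg_wsum hc (fun k => hy k.+1).
apply/cvg_lim => //; rewrite -cvg_shiftS/=.
have -> : (fun n => series (fun k => c ^+ k * y k) n.+1) =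
    (fun n => y 0 + c * series (fun k => c ^+ k * y k.+1) n).
  apply/funext => n; rewrite /series/= big_nat_recl// expr0 mul1r mulr_sumr.
  by congr (_ + _); apply: eq_bigr => i _; rewrite exprS mulrA.
by apply: cvgD; [exact: cvg_cst|apply: cvgMl_tmp].
Qed.

Lemma wsum_le d d' : (forall k, 0 <= d k) -> (forall k, d k <= d' k) ->
  (forall k, d' k <= 1) -> wsum 2^-1 d <= wsum 2^-1 d'.
Proof.
move=> d0 dd' d'1; apply: lim_series_le => [||k].
- by apply: is_cvg_wsum => [|k]; rewrite ger0_norm ?invr_ge0// (le_trans (dd' k)).
- by apply: is_cvg_wsum => [|k]; rewrite ger0_norm ?invr_ge0// (le_trans (d0 k)).
- by rewrite ler_wpM2l// exprn_ge0// invr_ge0.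
Qed.

Lemma wsum_half_cst a : `|a| <= 1 -> wsum 2^-1 (fun=> a) = 2 * a.
Proof.
move=> ha; have := @wsum_rec 2^-1 (fun=> a).
rewrite ger0_norm ?invr_ge0// => /(_ (lexx _) (fun=> ha)); lra.
Qed.

Lemma norm_wsum_le c y d : `|c| <= 2^-1 -> (forall k, `|y k| <= d k) ->
  (forall k, d k <= 1) -> `|wsum c y| <= wsum 2^-1 d.
Proof.
move=> hc hy d1; have y1 k : `|y k| <= 1 := le_trans (hy k) (d1 k).
have := is_cvg_wsum_normed hc y1.
move=> cn; apply: le_trans (lim_series_norm cn) _; apply: lim_series_le => [//||k].
- apply: is_cvg_wsum => [|k]; first by rewrite ger0_norm ?invr_ge0.
  by rewrite ger0_norm// (le_trans (normr_ge0 _) (hy k)).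
- rewrite /= normrM normrX ler_pM ?exprn_ge0//.
  by rewrite lerXn2r ?nnegrE// invr_ge0.
Qed.

Lemma dist_wsum_le c y z d : `|c| <= 2^-1 ->
    (forall k, `|y k| <= 1) -> (forall k, `|z k| <= 1) ->
    (forall k, `|y k - z k| <= d k) -> (forall k, d k <= 1) ->
  `|wsum c y - wsum c z| <= wsum 2^-1 d.
Proof.
move=> hc hy hz hd d1.
have -> : wsum c y - wsum c z = wsum c (fun k => 1 * y k + (-1) * z k).
  by rewrite wsum_lin// mul1r mulN1r.
by apply: norm_wsum_le => // k; rewrite mul1r mulN1r.
Qed.

Lemma dist_wsum_le_cst c y z a : `|c| <= 2^-1 ->
    (forall k, `|y k| <= 1) -> (forall k, `|z k| <= 1) ->
    (forall k, `|y k - z k| <= a) -> a <= 1 ->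
  `|wsum c y - wsum c z| <= 2 * a.
Proof.
move=> hc hy hz hd a1; rewrite -wsum_half_cst; first exact: dist_wsum_le.
by rewrite ger0_norm// (le_trans _ (hd 0)).
Qed.

Lemma norm_wsum_le_cst c y a : `|c| <= 2^-1 -> (forall k, `|y k| <= a) -> a <= 1 ->
  `|wsum c y| <= 2 * a.
Proof.
move=> hc hy a1; rewrite -wsum_half_cst; first exact: norm_wsum_le.
by rewrite ger0_norm// (le_trans _ (hy 0)).
Qed.

Lemma continuous_wsum {X : topologicalType} c (g : nat -> X -> R) (x : X) :
    `|c| <= 2^-1 -> (forall k t, `|g k t| <= 1) ->
    (forall k, {for x, continuous (g k)}) ->
  {for x, continuous (fun t => wsum c (fun k => g k t))}.
Proof.
move=> hc hg cg.
(* Induction for all families at once: the first term moves by at most [e / 2] and the shifted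
   family enters with factor at most 1/2. The constant 4 bounds the difference of two sums of
   absolute value at most 2. *)
have near_wsum (n : nat) : forall g : nat -> X -> R, (forall k t, `|g k t| <= 1) ->
    (forall k, {for x, continuous (g k)}) -> forall e : R, 0 < e ->
    \forall t \near x, `|wsum c (fun k => g k x) - wsum c (fun k => g k t)| <=
      e + 4 * 2^-1 ^+ n.
  elim: n => [|n IH] {hg cg}g hg cg e e0.
    apply: nearW => t.
    have h (u : X) : `|wsum c (fun k => g k u)| <= 2.
      by rewrite -[leRHS]mulr1; apply: norm_wsum_le_cst => // k; exact: hg.
    have := h x; have := h t; rewrite expr0 !ler_norml => /andP[h1 h2] /andP[h3 h4].
    by apply/andP; split; lra.
  have e2 : 0 < e / 2 by lra.
  have := IH (fun k => g k.+1) (fun k => hg k.+1) (fun k => cg k.+1) _ e0.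
  have /cvgrPdist_lt/(_ _ e2) := cg 0; apply: filterS2 => t h1 h2.
  rewrite !(@wsum_rec c (g^~ _))// opprD addrACA -mulrBr.
  apply: le_trans (ler_normD _ _) _; rewrite normrM.
  have {}h2 := ler_pM (normr_ge0 _) (normr_ge0 _) hc h2.
  apply: le_trans (lerD (ltW h1) h2) _; rewrite exprS; lra.
apply/cvgrPdist_le => e e0.
have e2 : 0 < e / 2 by lra.
have [N hN] : exists N, 4 * (2^-1 : R) ^+ N <= e / 2.
  have : geometric 4 (2^-1 : R) @ \oo --> 0.
    by apply: cvg_geometric; rewrite ger0_norm ?invr_ge0//; lra.
  move=> /cvgrPdist_lt/(_ _ e2)[N _ /(_ N (leqnn N))].
  by rewrite /= sub0r normrN => /ltW/(le_trans (ler_norm _)); exists N.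
have := near_wsum N g hg cg _ e2; apply: filterS => t h.
by apply: le_trans h _; lra.
Qed.

End WeightedSums.

(** * Fibres over the points of the line: segments that vary upper semicontinuously *)

Section Fibres.
Context {R : realType} (omega : R).
Implicit Types (s t x a b : R) (y z : nat -> R).

Definition orb t (k : nat) : R := t + k%:R * omega.

Lemma orb0 t : orb t 0 = t.
Proof. by rewrite /orb mul0r addr0. Qed.

Lemma orbS t k : orb (t + omega) k = orb t k.+1.
Proof. by rewrite /orb -natr1; ring. Qed.

Lemma orbB s t k : orb s k - orb t k = s - t.
Proof. by rewrite /orb; ring. Qed.

(** Complement of the backward orbit of the integers; fibres are single points there. *)
Definition generic : set R := [set t | forall k, orb t k \isn't a Num.int].

(* The sequences [y] which, read along the forward orbit of [t], lie in the closure
   of the graph of [osc]: all values of [0, 1/2] are allowed over the integers. *)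
Definition compatible t y := forall k,
  0 <= y k <= 2^-1 /\ (orb t k \isn't a Num.int -> y k = osc (orb t k)).

Definition altsum y : R := wsum (- 2^-1) y.

Definition fibre t : set R := [set x | exists2 y, compatible t y & x = altsum y].

(** Lift of the function phi. Over a non-generic point it selects one point of the fibre, through
    the value 0 of [osc] at the integers. *)
Definition phi_lift t : R := altsum (fun k => osc (orb t k)).

(** Bounds how far the fibre over [t + d] sticks out of the fibre over [t]. Indices with [orb t k]
    an integer contribute 0, rightly so: the coordinate is free there. *)
Definition fibre_mod t d : R := wsum 2^-1 (fun k => osc_mod (orb t k) d).

Let half_le : `|- 2^-1 : R| <= 2^-1.
Proof. by rewrite normrN ger0_norm ?invr_ge0. Qed.

Lemma compatible_le1 t y : compatible t y -> forall k, `|y k| <= 1.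
Proof.
by move=> cy k; have [/andP[y0 y1] _] := cy k; rewrite ger0_norm//; lra.
Qed.

Lemma compatible_osc t : compatible t (fun k => osc (orb t k)).
Proof. by move=> k; split => //; exact: osc_bounds. Qed.

Lemma fibre_phi_lift t : fibre t (phi_lift t).
Proof. by eexists; first exact: compatible_osc. Qed.

Lemma compatibleS t y : compatible t y -> compatible (t + omega) (fun k => y k.+1).
Proof. by move=> cy k; rewrite orbS. Qed.

Lemma compatible_cons t y : compatible (t + omega) y ->
  compatible t (fun k => if k is k'.+1 then y k' else osc t).
Proof.
move=> cy [|k]; last by rewrite -orbS.
by rewrite orb0; split => //; exact: osc_bounds.
Qed.

Lemma compatibleD_int t n y : n \is a Num.int -> compatible t y -> compatible (t + n) y.
Proof.
move=> nint cy k; have [yk yo] := cy k; split => //.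
by rewrite /orb addrAC rpredDr// oscD_int.
Qed.

Lemma fibre_congr s t x : s - t \is a Num.int -> fibre t x -> fibre s x.
Proof.
move=> st [y cy ->]; exists y => //.
by rewrite -(subrKC t s); exact: compatibleD_int.
Qed.

Lemma phi_lift_congr s t : s - t \is a Num.int -> phi_lift s = phi_lift t.
Proof.
move=> st; congr altsum; apply/funext => k.
by rewrite -(subrKC (orb t k) (orb s k)) oscD_int// orbB.
Qed.

Lemma fibre_generic t x : generic t -> fibre t x -> x = phi_lift t.
Proof.
by move=> gt [y cy ->]; congr altsum; apply/funext => k; apply: (cy k).2; exact: gt.
Qed.

Lemma norm_fibre_le1 t x : fibre t x -> `|x| <= 1.
Proof.
move=> [y cy ->]; have -> : 1 = 2 * 2^-1 :> R by lra.
apply: norm_wsum_le_cst => [//|k|]; last by lra.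
by have [/andP[y0 y1] _] := cy k; rewrite ger0_norm.
Qed.

(** This is [wsum_rec] at [c = - 2^-1], solved for the tail. *)
Lemma altsum_rec y : (forall k, `|y k| <= 1) ->
  altsum (fun k => y k.+1) = 2 * (y 0 - altsum y).
Proof. by move=> hy; rewrite /altsum (wsum_rec half_le hy); lra. Qed.

Lemma fibre_mod_ge0 t d : 0 <= fibre_mod t d.
Proof.
have -> : 0 = wsum 2^-1 (fun=> 0 : R).
  by rewrite wsum_half_cst ?mulr0// normr0.
apply: wsum_le => k //; first exact: osc_mod_ge0.
by apply: le_trans (osc_mod_le_half _ _) _; lra.
Qed.

Lemma fibre_mod_int t d : d \is a Num.int -> fibre_mod t d = 0.
Proof.
move=> dint; rewrite /fibre_mod (_ : (fun k => _) = (fun=> 0 : R)).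
  by rewrite wsum_half_cst ?mulr0// normr0.
by apply/funext => k; exact: osc_mod_int.
Qed.

Lemma continuous_fibre_mod t : continuous (fibre_mod t).
Proof.
move=> d; apply: (continuous_wsum (g := fun k => osc_mod (orb t k))).
- by rewrite ger0_norm ?invr_ge0.
- move=> k u; rewrite ger0_norm ?osc_mod_ge0//.
  by apply: le_trans (osc_mod_le_half _ _) _; lra.
- by move=> k; exact: continuous_osc_mod.
Qed.

Lemma fibre_mod_small t (e : R) : 0 < e ->
  \forall s \near t, fibre_mod t (s - t) < e.
Proof.
move=> e0.
have ct : {for t, continuous (fun s => fibre_mod t (s - t))}.
  apply: continuous_comp; last exact: continuous_fibre_mod.
  by apply: cvgB; [exact: cvg_id|exact: cvg_cst].
have /cvgrPdist_lt/(_ _ e0) := ct; apply: filterS => s /=.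
rewrite subrr fibre_mod_int ?rpred0// sub0r normrN.
exact/le_lt_trans/ler_norm.
Qed.

(** Makes a sequence compatible with [t]: coordinates that are free over [t] are kept, the others
    are reset to their forced value. *)
Definition resync t y k := if orb t k \is a Num.int then y k else osc (orb t k).

Lemma compatible_resync s t y : compatible s y -> compatible t (resync t y).
Proof.
move=> cy k; rewrite /resync; case: ifPn => [_|_]; first by have [] := cy k.
by split => //; exact: osc_bounds.
Qed.

Lemma dist_resync s t y k : compatible s y ->
  `|y k - resync t y k| <= osc_mod (orb t k) (s - t).
Proof.
move=> cy; rewrite /resync; case: ifPn => [_|tn].
  by rewrite subrr normr0 osc_mod_ge0.
have [/andP[y0 y1] yo] := cy k.
have [sint|sn] := boolP (orb s k \is a Num.int); last first.
  by rewrite (yo sn) -(orbB s t k) osc_diff.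
have /andP[u0 u1] := osc_bounds (orb t k).
(* As [orb s k] is an integer, [orb t k] is at distance [dist_int (s - t)] from the integers. The
   modulus is then at its cap 1/2, the length of the range of both values. *)
rewrite osc_mod_far//; first by rewrite ler_norml; apply/andP; split; lra.
have -> : dist_int (orb t k) = dist_int (s - t).
  rewrite -(orbB s t k) -[RHS]dist_intN opprB.
  by rewrite (@dist_intD_int _ (orb t k) (- orb s k)) ?rpredN.
by have := dist_int_ge0 (s - t); lra.
Qed.

Lemma dist_altsum_resync s t y : compatible s y ->
  `|altsum y - altsum (resync t y)| <= fibre_mod t (s - t).
Proof.
move=> cy; apply: dist_wsum_le => //.
- exact: compatible_le1 cy.
- exact: compatible_le1 (compatible_resync t cy).
- by move=> k; exact: dist_resync.
- by move=> k; apply: le_trans (osc_mod_le_half _ _) _; lra.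
Qed.

(** The witness is the resynchronised sequence. This yields closedness of the invariant set,
    continuity of phi at generic points, and the band that makes the fibre maps continuous. *)
Lemma fibre_usc s t x : fibre s x ->
  exists2 x', fibre t x' & `|x - x'| <= fibre_mod t (s - t).
Proof.
move=> [y cy ->]; exists (altsum (resync t y)); last exact: dist_altsum_resync.
by exists (resync t y) => //; exact: compatible_resync cy.
Qed.

Lemma fibre_convex t a b (l : R) : 0 <= l <= 1 -> fibre t a -> fibre t b ->
  fibre t ((1 - l) * a + l * b).
Proof.
move=> /andP[l0 l1] [y cy ->] [z cz ->].
exists (fun k => (1 - l) * y k + l * z k).
  move=> k; have [/andP[y0 y1] yo] := cy k; have [/andP[z0 z1] zo] := cz k.
  split; first by apply/andP; split; nra.
  by move=> tn; rewrite yo// zo//; ring.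
by rewrite /altsum wsum_lin//; [exact: compatible_le1 cy|exact: compatible_le1 cz].
Qed.

Lemma fibre_is_interval t : is_interval (fibre t).
Proof.
move=> a b fa fb x /andP[].
rewrite le_eqVlt => /predU1P[<-//|ax].
rewrite le_eqVlt => /predU1P[->//|xb].
have ab : 0 < b - a by lra.
have -> : x = (1 - (x - a) / (b - a)) * a + (x - a) / (b - a) * b.
  by field; rewrite gt_eqF.
apply: fibre_convex => //.
by rewrite divr_ge0 ?ler_pdivrMr//=; lra.
Qed.

(* Odd coefficients of [altsum] are negative, so [extremal] with [b = false]
   (resp. [true]) yields the lower (resp. upper) end of the fibre. *)
Definition extremal (b : bool) t k : R :=
  if orb t k \is a Num.int then (if odd k (+) b then 2^-1 else 0)
  else osc (orb t k).

Lemma compatible_extremal (b : bool) t : compatible t (extremal b t).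
Proof.
move=> k; rewrite /extremal; case: ifPn => _; last first.
  by split => //; exact: osc_bounds.
by split => //; case: ifP; rewrite ?lexx ?invr_ge0// ler0n.
Qed.

Lemma altsum_le y z : (forall k, `|y k| <= 1) -> (forall k, `|z k| <= 1) ->
  (forall k, (-1) ^+ k * y k <= (-1) ^+ k * z k) -> altsum y <= altsum z.
Proof.
move=> hy hz hyz; apply: lim_series_le => [||k].
- exact: is_cvg_wsum.
- exact: is_cvg_wsum.
- rewrite -mulN1r exprMn -mulrAC -[leRHS]mulrAC.
  by rewrite ler_wpM2r ?exprn_ge0// ?invr_ge0// hyz.
Qed.

Lemma fibre_between t x : fibre t x ->
  altsum (extremal false t) <= x <= altsum (extremal true t).
Proof.
move=> [y cy ->]; have hy := compatible_le1 cy.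
have he (b : bool) := compatible_le1 (compatible_extremal b t).
by apply/andP; split; apply: altsum_le => // k; rewrite /extremal -signr_odd;
  have [/andP[y0 y1] yo] := cy k; case: ifPn => [_|/yo -> //];
  case: (odd k); rewrite /= ?expr0 ?expr1; lra.
Qed.

(** The fibre is the whole segment between its two extremal sums, so two non-strict inequalities
    suffice, and these pass to the limit. *)
Lemma fibre_closed t x :
  (forall e : R, 0 < e -> exists2 x', fibre t x' & `|x - x'| <= e) -> fibre t x.
Proof.
move=> h; apply: (@fibre_is_interval t (altsum (extremal false t))
  (altsum (extremal true t))).
- by exists (extremal false t) => //; exact: compatible_extremal.
- by exists (extremal true t) => //; exact: compatible_extremal.
- apply/andP; split; apply/ler_addgt0Pr => e /h[x' /fibre_between/andP[h1 h2]];
    rewrite ler_norml => /andP[h3 h4]; lra.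
Qed.

End Fibres.

(** * Density of orbits, of generic points and of singular points *)

Section Density.
Context {R : realType}.
Implicit Types (omega s t a b : R).

Definition aperiodic omega := forall k : nat, (0 < k)%N -> k%:R * omega \isn't a Num.int.

Lemma irrational_aperiodic omega : irrational omega -> aperiodic omega.
Proof.
move=> irr k k0; apply/negP => /intrP[m kw]; apply: irr.
have kn : k%:R != 0 :> R by rewrite pnatr_eq0 -lt0n.
exists (m%:~R / k%:R) => //.
by rewrite rmorphM/= fmorphV/= ratr_int ratr_nat -kw mulrC mulKf.
Qed.

Lemma aperiodicN omega : aperiodic omega -> aperiodic (- omega).
Proof. by move=> ap k /ap; rewrite mulrN rpredN. Qed.

(** Pigeonhole principle: among the fractional parts of [N + 2] multiples of [omega], two share one
    of [N + 1] boxes of length [1 / (N + 1)]. They are distinct by aperiodicity. *)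
Lemma aperiodic_return omega (e : R) : aperiodic omega -> 0 < e ->
  exists2 j : nat, (0 < j)%N & exists m : int, 0 < `|j%:R * omega + m%:~R| < e.
Proof.
move=> ap e0.
have [N] := ltr_add_invr e0; rewrite add0r => hN.
pose fr (i : nat) : R := i%:R * omega - (Num.floor (i%:R * omega))%:~R.
have fr01 i : 0 <= fr i < 1.
  have /andP[h1] := floor_itv (i%:R * omega); rewrite intrD /fr => h2.
  by apply/andP; split; lra.
have N0 : 0 < N.+1%:R :> R by rewrite ltr0n.
have frN i : 0 <= N.+1%:R * fr i by have /andP[h _] := fr01 i; rewrite mulr_ge0// ltW.
have box_lt i : (Num.truncn (N.+1%:R * fr i) < N.+1)%N.
  by rewrite truncn_lt_nat// -[ltRHS]mulr1 ltr_pM2l//; have /andP[] := fr01 i.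
pose box (i : 'I_N.+2) : 'I_N.+1 := Ordinal (box_lt i).
have /injectivePn[i1 [i2 i12 /(congr1 val)/= eqb]] : ~~ injectiveb box.
  apply/negP => /injectiveP/leq_card; rewrite !card_ord; lia.
wlog lti : i1 i2 i12 eqb / (i1 < i2)%N.
  move=> hw; have [lt12|lt21|/val_inj eq12] := ltngtP i1 i2; first exact: (hw i1 i2).
    by apply: (hw i2 i1); rewrite // eq_sym.
  by rewrite eq12 eqxx in i12.
exists (i2 - i1)%N; first by rewrite subn_gt0.
exists (Num.floor (i1%:R * omega) - Num.floor (i2%:R * omega)).
have -> : (i2 - i1)%:R * omega
    + (Num.floor (i1%:R * omega) - Num.floor (i2%:R * omega))%:~R = fr i2 - fr i1.
  by rewrite natrB ?(ltnW lti)// intrB /fr; ring.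
apply/andP; split.
  rewrite normr_gt0 subr_eq0 /fr; apply/eqP => eqf.
  have /negP[] := ap (i2 - i1)%N ltac:(by rewrite subn_gt0).
  rewrite natrB ?(ltnW lti)// (_ : _ * omega =
    (Num.floor (i2%:R * omega))%:~R - (Num.floor (i1%:R * omega))%:~R).
    by rewrite -intrB intr_int.
  by lra.
have := truncn_itv (frN i1); have := truncn_itv (frN i2).
rewrite eqb -natr1; set q := (Num.truncn _)%:R => /andP[h1 h2] /andP[h3 h4].
apply: lt_trans hN; rewrite -[ltRHS]mul1r ltr_pdivlMr//.
rewrite -[X in _ * X](gtr0_norm N0) -normrM mulrC mulrBr ltr_norml.
by apply/andP; split; lra.
Qed.

(** Multiples of a return [d] shorter than [b - a] cannot jump over the interval: climb from the
    floor of [a] if [d] is positive, descend from the ceiling of [b] otherwise. *)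
Lemma aperiodic_dense omega a b : aperiodic omega -> a < b ->
  exists2 j : nat, (0 < j)%N & exists m : int, a < j%:R * omega + m%:~R < b.
Proof.
move=> ap ab; have ba : 0 < b - a by lra.
have [j j0 [m /andP[d0 db]]] := aperiodic_return ap ba.
set d := _ + _ in d0 db.
have steps x : 0 <= x -> exists2 i : nat, (0 < i)%N & x < i%:R * `|d| <= x + `|d|.
  move=> x0; have x0d : 0 <= x / `|d| by rewrite divr_ge0.
  have := truncn_itv x0d; set i := Num.truncn _ => /andP[h1 h2].
  exists i.+1 => //; rewrite -ltr_pdivrMr// h2/=.
  by rewrite -natr1 mulrDl mul1r lerD2r -ler_pdivlMr.
have fin (i : nat) (M : int) : a < i%:R * d + M%:~R < b -> (0 < i)%N ->
    exists2 j : nat, (0 < j)%N & exists m : int, a < j%:R * omega + m%:~R < b.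
  move=> h i0; exists (i * j)%N; first by rewrite muln_gt0 i0.
  exists (i%:Z * m + M).
  rewrite (_ : _ + _ = i%:R * d + M%:~R)// /d natrM intrD intrM -pmulrn; ring.
have [dp|dn] := ltrP 0 d.
  have hM := floor_le a.
  have [|i i0] := steps (a - (Num.floor a)%:~R); first by lra.
  rewrite gtr0_norm // => /andP[h1 h2].
  apply: (fin i (Num.floor a)) => //; rewrite gtr0_norm// in db.
  by apply/andP; split; lra.
have hM := ceil_ge b.
have [|i i0] := steps ((Num.ceil b)%:~R - b); first by lra.
rewrite ler0_norm // => /andP[h1 h2].
apply: (fin i (Num.ceil b)) => //; rewrite ler0_norm// in db.
by apply/andP; split; lra.
Qed.

(** The points [j * omega + m] with [j] positive will do: modulo 1, their forward orbits consist of
    positive multiples of [omega]. *)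
Lemma generic_dense omega a b : aperiodic omega -> a < b ->
  exists2 s, generic omega s & a < s < b.
Proof.
move=> ap /(aperiodic_dense ap)[j j0 [m h]].
exists (j%:R * omega + m%:~R) => // k.
rewrite /orb addrAC -mulrDl -natrD rpredDr ?intr_int//.
by apply: ap; rewrite addn_gt0 j0.
Qed.

(** Preimages of 0 under the rotation, found by density for [- omega]. *)
Lemma singular_dense omega a b : aperiodic omega -> a < b ->
  exists2 s, a < s < b & exists k, orb omega s k \is a Num.int.
Proof.
move=> /aperiodicN ap /(aperiodic_dense ap)[j j0 [m h]].
exists (j%:R * - omega + m%:~R) => //; exists j.
by rewrite /orb mulrN addrAC addNr add0r intr_int.
Qed.

Lemma generic_near omega s (P : set R) : aperiodic omega ->
  (\forall u \near s, P u) -> exists2 u, generic omega u & P u.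
Proof.
move=> ap /nbhs_ballP[e /= e0 sP].
have [|u gu /andP[u1 u2]] := @generic_dense omega (s - e) (s + e) ap; first lra.
exists u => //; apply: sP; rewrite /ball/= ltr_norml; apply/andP; split; lra.
Qed.

(** Two visits would make a positive multiple of [omega] an integer. Hence a fibre has at most one
    free coordinate. *)
Lemma singular_unique omega t (k j : nat) : aperiodic omega ->
  orb omega t k \is a Num.int -> orb omega t j \is a Num.int -> k = j.
Proof.
move=> ap; wlog kj : k j / (k < j)%N.
  move=> hw hk hj; have [lt|lt|//] := ltngtP k j; first exact: hw.
  by apply/esym; exact: hw.
move=> hk hj; have /negP[] := ap (j - k)%N ltac:(by rewrite subn_gt0).
rewrite natrB ?(ltnW kj)// (_ : _ * omega = orb omega t j - orb omega t k).
  by rewrite rpredB.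
by rewrite /orb; ring.
Qed.

(** Over a singular [t] only the coordinate [k] is free. Shift [t] by a small [u] at which [osc]
    takes exactly the wanted value [r], then perturb to a generic point; [fibre_mod_small] controls
    the other coordinates. *)
Lemma fibre_approx omega t x (e : R) : aperiodic omega -> fibre omega t x -> 0 < e ->
  exists2 s, generic omega s & `|s - t| < e /\ `|phi_lift omega s - x| < e.
Proof.
move=> ap fx e0.
have [gt|/existsNP[k /negP/negPn tk]] := pselect (generic omega t).
  by exists t => //; rewrite (fibre_generic gt fx) !subrr normr0.
case: fx => y cy ->; have [/andP[r0 r1] _] := cy k; set r := y k in r0 r1.
have e2 : 0 < e / 2 by lra.
(* The error [a] counts at most twice, which leaves room besides the [e / 2] spent on [fibre_mod];
   the bound 1 is required by [dist_wsum_le_cst]. *)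
pose a := Num.min (e / 8) 1.
have a0 : 0 < a by rewrite lt_min ltr01 andbT; lra.
have a1 : a <= 1 by rewrite ge_min lexx orbT.
have ae : a <= e / 8 by rewrite ge_min lexx.
have /nbhs_ballP[d /= d0 dP] := fibre_mod_small omega t e2.
pose d' := Num.min d e.
have d'0 : 0 < d' by rewrite lt_min d0.
have [n] := ltr_add_invr (divr_gt0 d'0 (ltr0n R 2)); rewrite add0r => hn.
pose u := (n.+2%:R + r)^-1; pose s1 := t + u.
have n0 : 0 < n.+1%:R :> R by rewrite ltr0n.
have nr : n.+2%:R + r = n.+1%:R + 1 + r by rewrite -natr1.
have u0 : 0 < u by rewrite invr_gt0 nr; lra.
have un : u < d' / 2.
  by apply: le_lt_trans hn; rewrite lef_pV2 ?posrE ?nr; lra.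
have u2 : u <= 2^-1.
  have h1 : 1 <= n.+1%:R :> R by rewrite ler1n.
  by rewrite lef_pV2 ?posrE ?nr; lra.
have orb_s1 : orb omega s1 k = u + orb omega t k by rewrite /orb /s1; ring.
have s1k : orb omega s1 k \isn't a Num.int.
  by rewrite orb_s1 rpredDr// -dist_int_eq0 dist_int_id ?gt_eqF// (ltW u0).
have osc_s1 : osc (orb omega s1 k) = r.
  by rewrite orb_s1 oscD_int// osc_attains// r0.
have cosc : {for s1, continuous (fun s => osc (orb omega s k))}.
  apply: continuous_comp; last exact: continuous_osc.
  by apply: cvgD; [exact: cvg_id|exact: cvg_cst].
have near1 : \forall s \near s1, `|osc (orb omega s k) - r| < a.
  have /cvgrPdist_lt/(_ _ a0) := cosc; apply: filterS => s.
  by rewrite osc_s1 distrC.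
have near2 : \forall s \near s1, `|s1 - s| < d' / 2.
  by apply/nbhs_ballP; exists (d' / 2) => //=; lra.
have [s gs [h1 h2]] := generic_near ap (filterI near1 near2).
have st : `|s - t| < d'.
  have -> : s - t = u - (s1 - s) by rewrite /s1; ring.
  by apply: le_lt_trans (ler_normB _ _) _; rewrite (gtr0_norm u0); lra.
exists s => //; split; first by move: st; rewrite lt_min => /andP[].
have cs := compatible_osc omega s.
set z := fun i => osc (orb omega s i) in cs.
have cz := compatible_resync t cs.
have hz : `|phi_lift omega s - altsum (resync omega t z)| < e / 2.
  apply: le_lt_trans (dist_altsum_resync t cs) _; apply: dP.
  by rewrite /ball/= distrC; move: st; rewrite lt_min => /andP[].
(* The two sequences can differ only at [k], where they are [osc (orb omega s k)] and [r]. *)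
have hy : `|altsum (resync omega t z) - altsum y| <= 2 * a.
  apply: dist_wsum_le_cst => //.
  - by rewrite normrN ger0_norm ?invr_ge0.
  - exact: compatible_le1 cz.
  - exact: compatible_le1 cy.
  move=> i; rewrite /resync; case: ifPn => [ti|tn].
    by rewrite (singular_unique ap ti tk) ltW.
  by rewrite (cy i).2// subrr normr0 ltW.
by apply: le_lt_trans (ler_distD (altsum (resync omega t z)) _ _) _; lra.
Qed.

Lemma wsum_single c a (k : nat) : `|c| <= 2^-1 -> `|a| <= 1 ->
  wsum c (fun j => if j == k then a else 0) = c ^+ k * a.
Proof.
move=> hc ha; have h1 (i : nat) j : `|if j == i then a else 0| <= 1.
  by case: ifP; rewrite ?normr0.
elim: k => [|k IH]; rewrite wsum_rec//=; last by rewrite IH add0r exprS mulrA.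
have -> : wsum c (fun=> 0) = 0; last by rewrite mulr0 addr0 mul1r.
apply/eqP; rewrite -normr_le0.
by rewrite -[leRHS](mulr0 2) norm_wsum_le_cst// normr0.
Qed.

(** Raising the free coordinate from 0 to 1/2 changes the sum by half of [(- 2^-1) ^+ k], which is
    not 0. *)
Lemma fibre_singular omega t (k : nat) : orb omega t k \is a Num.int ->
  exists2 x, fibre omega t x & x != phi_lift omega t.
Proof.
move=> tk; pose y j := 1 * osc (orb omega t j) + 1 * (if j == k then 2^-1 else 0 : R).
have half1 : `|2^-1 : R| <= 1 by rewrite ger0_norm; lra.
have osck : osc (orb omega t k) = 0.
  have /eqP h0 : dist_int (orb omega t k) == 0 by rewrite dist_int_eq0.
  by rewrite /osc h0 invr0; apply/eqP; rewrite dist_int_eq0 rpred0.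
exists (altsum y).
  exists y => // j; rewrite /y !mul1r; case: eqVneq => [->|_].
    by rewrite osck add0r tk; split => //; rewrite lexx invr_ge0 ler0n.
  by rewrite addr0; split => //; exact: osc_bounds.
have hc : `|- 2^-1 : R| <= 2^-1 by rewrite normrN ger0_norm ?invr_ge0.
rewrite /altsum wsum_lin//; last 2 first.
- exact: compatible_le1 (compatible_osc omega t).
- by move=> j; case: ifP; rewrite ?normr0.
rewrite wsum_single// !mul1r -subr_eq0 addrC addKr.
by rewrite mulf_neq0// ?expf_neq0// ?oppr_eq0 invr_neq0// pnatr_eq0.
Qed.

End Density.

(** * The decreasing maps from a fibre to the next one *)

Section FibreMap.
Context {R : realType} (omega : R).
Implicit Types (s t x y : R).

Let v : R := phi_lift omega omega.

(** The half-width is the modulus at [omega]; once [omega] is generic, [fibre_usc] puts the fibre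
    over [t + omega] in this band. Cutting at -1 and 1 loses nothing of that fibre and keeps the
    affine bounds of [fibre_map] inactive for [|x| <= 1]. *)
Definition band_lo t : R := Num.max (-1) (v - fibre_mod omega omega t).
Definition band_hi t : R := Num.min 1 (v + fibre_mod omega omega t).

(* On the invariant set the next point is [2 * (osc t - x)]; the band pinches at the
   integers, which kills the discontinuity of [osc] there. The two affine bounds are
   inactive for [`|x| <= 1]; they are there to exchange [2] and [-2]. *)
Definition fibre_map t x : R :=
  Num.max (- 4 - 3 * x) (Num.min (4 - 3 * x)
    (Num.max (band_lo t) (Num.min (band_hi t) (2 * (osc t - x))))).

Lemma band_bounds t : [/\ -1 <= band_lo t, band_lo t <= v, v <= band_hi t
  & band_hi t <= 1].
Proof.
have := norm_fibre_le1 (fibre_phi_lift omega omega).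
rewrite -/v ler_norml => /andP[v1 v2].
have e0 := fibre_mod_ge0 omega omega t.
rewrite /band_lo /band_hi le_max lexx ge_min lexx ge_max le_min v1 v2 /=.
by split => //; lra.
Qed.

Lemma band_int t : t \is a Num.int -> band_lo t = v /\ band_hi t = v.
Proof.
move=> tint; have [h1 h2 h3 h4] := band_bounds t.
rewrite /band_lo /band_hi fibre_mod_int// addr0 subr0.
by split; [apply: max_r|apply: min_r]; lra.
Qed.

Lemma fibre_map_anti t x y : x <= y -> fibre_map t y <= fibre_map t x.
Proof. by move=> xy; rewrite le_max2 ?le_min2 ?le_max2 ?le_min2//; lra. Qed.

Lemma fibre_map_itv t x : -2 <= x <= 2 -> -2 <= fibre_map t x <= 2.
Proof.
move=> /andP[x1 x2]; have [h1 h2 h3 h4] := band_bounds t.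
rewrite /fibre_map; move: (band_lo t) (band_hi t) h1 h2 h3 h4 => lo hi h1 h2 h3 h4.
rewrite !(le_max, ge_max, le_min, ge_min).
apply/andP; split; first by apply/orP; right; apply/andP; split; first lra; apply/orP; left; lra.
apply/andP; split; first lra.
by apply/orP; right; apply/andP; split; [|apply/orP; left]; lra.
Qed.

Lemma fibre_map_top t : fibre_map t 2 = -2.
Proof.
have [h1 h2 h3 h4] := band_bounds t; apply/le_anti/andP; split; last first.
  by have /andP[] := @fibre_map_itv t 2 ltac:(lra).
by rewrite ge_max ge_min; apply/andP; split; [|apply/orP; left]; lra.
Qed.

Lemma fibre_map_bot t : fibre_map t (-2) = 2.
Proof.
have [h1 h2 h3 h4] := band_bounds t; apply/le_anti/andP; split.
  by have /andP[] := @fibre_map_itv t (-2) ltac:(lra).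
by rewrite le_max; apply/orP; left; lra.
Qed.

Lemma fibre_map_congr s t x : s - t \is a Num.int -> fibre_map s x = fibre_map t x.
Proof.
move=> st; have dst : dist_int s = dist_int t.
  by rewrite -(subrKC t s) dist_intD_int.
have mst : fibre_mod omega omega s = fibre_mod omega omega t.
  by congr wsum; apply/funext => k; rewrite /osc_mod dst.
by rewrite /fibre_map /band_lo /band_hi mst /osc dst.
Qed.

Lemma fibre_mapE t x : -1 <= x <= 1 ->
  band_lo t <= 2 * (osc t - x) <= band_hi t -> fibre_map t x = 2 * (osc t - x).
Proof.
move=> /andP[x1 x2] /andP[h1 h2]; have [b1 _ _ b4] := band_bounds t.
rewrite /fibre_map (min_r h2) (max_r h1) min_r ?max_r//; lra.
Qed.

Lemma fibre_map_int t x : t \is a Num.int -> -1 <= x <= 1 -> fibre_map t x = v.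
Proof.
move=> tint /andP[x1 x2]; have [b1 _ _ b4] := band_bounds t.
have [lo hi] := band_int tint; rewrite lo hi in b1 b4.
have core z : Num.max v (Num.min v z) = v by apply: max_l; rewrite ge_min lexx.
rewrite /fibre_map lo hi core.
by rewrite min_r ?max_r//; lra.
Qed.

(** Off the integers the first coordinate is [osc t] and [altsum_rec] applies. At an integer that
    coordinate is free, but the band reduces to a point, which the shifted sum must equal. *)
Lemma fibre_map_altsum t (y : nat -> R) : generic omega omega -> compatible omega t y ->
  fibre_map t (altsum y) = altsum (fun k => y k.+1).
Proof.
move=> gen cy; have cSy := compatibleS cy.
have y1 : -1 <= altsum y <= 1.
  by rewrite -ler_norml; apply: (@norm_fibre_le1 _ omega t); exists y.
have near_v : `|altsum (fun k => y k.+1) - v| <= fibre_mod omega omega t.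
  have fx : fibre omega (t + omega) (altsum (fun k => y k.+1)) by eexists; first exact: cSy.
  have [x' fx'] := fibre_usc omega fx.
  by rewrite (fibre_generic gen fx') addrK.
have hb : band_lo t <= altsum (fun k => y k.+1) <= band_hi t.
  have : `|altsum (fun k => y k.+1)| <= 1.
    by apply: (@norm_fibre_le1 _ omega (t + omega)); eexists; first exact: cSy.
  move: near_v; rewrite !ler_norml => /andP[n1 n2] /andP[a1 a2].
  by rewrite /band_lo /band_hi ge_max le_min; lra.
have [tint|tn] := boolP (t \is a Num.int).
  move: hb; have [-> ->] := band_int tint => /le_anti <-.
  by rewrite fibre_map_int.
have y0 : y 0%N = osc t.
  by have := (cy 0%N).2; rewrite orb0; exact.
by move: hb; rewrite (altsum_rec (compatible_le1 cy)) y0 => /(fibre_mapE y1).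
Qed.

Lemma continuous_band_lo : continuous band_lo.
Proof.
move=> u; apply: (continuous_max (f := fun=> -1)
  (g := fun t => v - fibre_mod omega omega t)); first exact: cvg_cst.
by apply: cvgB; [exact: cvg_cst|exact: continuous_fibre_mod].
Qed.

Lemma continuous_band_hi : continuous band_hi.
Proof.
move=> u; apply: (continuous_min (f := fun=> 1)
  (g := fun t => v + fibre_mod omega omega t)); first exact: cvg_cst.
by apply: cvgD; [exact: cvg_cst|exact: continuous_fibre_mod].
Qed.

Lemma continuous_fibre_map : continuous (fun p : R * R => fibre_map p.1 p.2).
Proof.
move=> p.
have c1 : {for p, continuous (fun q : R * R => q.1)} by exact: cvg_fst.
have c2 : {for p, continuous (fun q : R * R => q.2)} by exact: cvg_snd.
have cl : {for p, continuous (fun q : R * R => band_lo q.1)}.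
  by apply: continuous_comp => //; exact: continuous_band_lo.
have ch : {for p, continuous (fun q : R * R => band_hi q.1)}.
  by apply: continuous_comp => //; exact: continuous_band_hi.
have c3 (a : R) : {for p, continuous (fun q : R * R => a - 3 * q.2)}.
  by apply: cvgB; [exact: cvg_cst|apply: cvgMl_tmp].
suff core : {for p, continuous (fun q : R * R =>
    Num.max (band_lo q.1) (Num.min (band_hi q.1) (2 * (osc q.1 - q.2))))}.
  exact: (continuous_max (c3 _) (continuous_min (c3 _) core)).
have [pint|pn] := boolP (p.1 \is a Num.int); last first.
  apply: (continuous_max cl); apply: (continuous_min ch).
  apply: cvgMl_tmp; apply: cvgB => //.
  by apply: (continuous_comp (g := osc) c1); exact: continuous_osc.
(* Here [osc] is discontinuous; the truncated term is squeezed between the two sides of the band,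
   which both tend to the value at the pinch. *)
have [lo hi] := band_int pint.
rewrite /prop_for /continuous_at lo hi.
rewrite (max_l (x := v)); last by rewrite ge_min lexx.
apply: (squeeze_cvgr (f := fun q : R * R => band_lo q.1)
  (h := fun q : R * R => band_hi q.1)); last 2 first.
- by rewrite -lo.
- by rewrite -hi.
apply: nearW => q; have [_ b2 b3 _] := band_bounds q.1.
by rewrite le_max lexx/= ge_max ge_min lexx/= andbT (le_trans b2).
Qed.

End FibreMap.

(** * Topology of the circle and of the interval, read on real numbers *)

Section CircleTopology.
Context {R : realType}.
Implicit Types (s t : R) (theta : S1 R) (x y : II R).

Lemma S1_piK theta : S1_pi (repr theta) = theta.
Proof. exact: reprK. Qed.

Lemma S1_pi_ind (P : S1 R -> Prop) : (forall t, P (S1_pi t)) -> forall theta, P theta.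
Proof. by move=> h theta; rewrite -(S1_piK theta). Qed.

Lemma repr_S1_pi t : repr (S1_pi t) - t \is a Num.int.
Proof. by apply/S1_pi_eq; rewrite S1_piK. Qed.

Lemma continuous_S1_pi : continuous (@S1_pi R).
Proof. exact: pi_continuous. Qed.

(** The preimage of the image is the union of the integer translates of [U]. *)
Lemma S1_pi_open (U : set R) : open U -> open (@S1_pi R @` U).
Proof.
move=> oU; suff : open (@S1_pi R @^-1` (@S1_pi R @` U)) by [].
rewrite openE => s [u Uu /esym/S1_pi_eq su].
have cs : {for s, continuous (fun z => z - (s - u))}.
  by apply: cvgB; [exact: cvg_id|exact: cvg_cst].
have sU : nbhs (s - (s - u)) U by apply: open_nbhs_nbhs; rewrite subKr.
have {}sU : \forall z \near s, U (z - (s - u)) := cs _ sU.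
rewrite /interior; apply: filterS sU => z /= Uz; exists (z - (s - u)) => //.
by apply/S1_pi_eq; rewrite addrAC subrr add0r rpredN.
Qed.

Lemma nbhs_S1_pi t (P : set (S1 R)) : nbhs (S1_pi t) P <-> \forall s \near t, P (S1_pi s).
Proof.
split=> [|/nbhs_interior tP]; first exact: continuous_S1_pi.
apply: (@filterS _ _ _ (@S1_pi R @` (interior (@S1_pi R @^-1` P)))).
  by move=> _ [s /interior_subset sP <-].
apply: open_nbhs_nbhs; split; first exact/S1_pi_open/open_interior.
by exists t => //; exact: nbhs_singleton tP.
Qed.

Lemma continuous_at_S1_pi {Z : topologicalType} (g : S1 R -> Z) t :
  {for t, continuous (fun s => g (S1_pi s))} -> {for S1_pi t, continuous g}.
Proof. by move=> cg W gW; apply/nbhs_S1_pi; exact: cg. Qed.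

(** The product of a quotient map with an identity need not be a quotient map; here openness of the
    projection makes it one. *)
Lemma continuous_S1_prod {Y Z : topologicalType} (g : S1 R * Y -> Z) :
  continuous (fun p : R * Y => g (S1_pi p.1, p.2)) -> continuous g.
Proof.
move=> cg [+ y]; apply: S1_pi_ind => t W /(cg (t, y)) [[U V] [/= tU yV] UVW].
exists (@S1_pi R @` U, V) => /=.
  by split => //; apply/nbhs_S1_pi; apply: filterS tU => s Us; exists s.
by move=> [_ z] /= [[s Us <-] Vz]; exact: (UVW (s, z)).
Qed.

Lemma continuous_pair {X Y Z : topologicalType} (f : X -> Y) (g : X -> Z) (x : X) :
  {for x, continuous f} -> {for x, continuous g} ->
  {for x, continuous (fun u => (f u, g u))}.
Proof. by move=> cf cg; exact: (cvg_pair cf cg). Qed.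

Lemma continuous_II_val : continuous (@II_val R).
Proof. exact: initial_continuous. Qed.

Lemma II_val_itv x : -2 <= II_val x <= 2.
Proof. by have /set_mem := valP x; rewrite /= in_itv. Qed.

Lemma II_val_inj : injective (@II_val R).
Proof. exact: val_inj. Qed.

Lemma clip_subproof (a : R) : Num.max (-2) (Num.min 2 a) \in `[(-2 : R), 2]%classic.
Proof. by rewrite mem_setE in_itv/= le_max lexx/= ge_max ge_min lexx/= andbT; lra. Qed.

Definition clip (a : R) : II R :=
  exist _ (Num.max (-2) (Num.min 2 a)) (clip_subproof a).

Lemma clipK (a : R) : -2 <= a <= 2 -> II_val (clip a) = a.
Proof. by move=> /andP[a1 a2]; rewrite /II_val/= min_r// max_r. Qed.

Lemma II_valK x : clip (II_val x) = x.
Proof. by apply: II_val_inj; rewrite clipK// II_val_itv. Qed.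

Lemma continuous_to_II {X : topologicalType} (g : X -> II R) (x : X) :
  {for x, continuous (fun u => II_val (g u))} -> {for x, continuous g}.
Proof.
move=> cg W [_ [/= [V oV <-] /= Vx VW]].
have gV : nbhs (II_val (g x)) V by apply: open_nbhs_nbhs.
have {}gV : \forall u \near x, V (II_val (g u)) := cg _ gV.
by apply: filterS gV => u; exact: VW.
Qed.

Lemma continuous_clip : continuous clip.
Proof.
move=> a; apply: continuous_to_II.
have c2 (b : R) : {for a, continuous (fun=> b : R)} by exact: cvg_cst.
exact: (continuous_max (c2 (-2)) (continuous_min (c2 2) cvg_id)).
Qed.

Lemma compact_II : compact [set: II R].
Proof.
have -> : [set: II R] = clip @` `[-2, 2].
  apply/seteqP; split => // x _; exists (II_val x); last exact: II_valK.
  by rewrite /= in_itv/= II_val_itv.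
apply: continuous_compact; last exact: segment_compact.
by apply: continuous_subspaceT; exact: continuous_clip.
Qed.

Lemma near_II (x : II R) (V : set (II R)) : nbhs x V ->
  exists2 e : R, 0 < e & forall y, `|II_val x - II_val y| < e -> V y.
Proof.
move=> [_ [/= [U oU <-] /= Ux UV]].
have /nbhs_ballP[e e0 eU] : nbhs (II_val x) U by apply: open_nbhs_nbhs.
by exists e => // y xy; apply: UV; exact: eU.
Qed.

(** Projection along a compact factor is closed: compactness of [II] makes the neighbourhoods of [t]
    that avoid [D] uniform in the second coordinate. *)
Lemma closed_proj (D : set (Omega R)) : closed D ->
  closed [set t | exists x, D (S1_pi t, x)].
Proof.
move=> cD; rewrite -openC openE => t /= /forallNP tD.
have /compact_near_coveringP near_cover := compact_II.
rewrite /interior; apply: filterS (near_cover _ (nbhs t)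
  (fun s x => ~ D (S1_pi s, x)) _ _) => [s sD [x]|x _]; first exact: sD.
have : nbhs ((S1_pi t, x) : Omega R) (~` D).
  by apply: open_nbhs_nbhs; split; [exact: closed_openC|exact: tD].
move=> [[U V] [/= /nbhs_S1_pi tU xV] UVD].
exists (V, [set s | U (S1_pi s)]) => // -[y s] [/= Vy Us]; exact: (UVD (_, _)).
Qed.

End CircleTopology.

(** * The skew product and its invariant pseudo-curve *)

Section SkewProduct.
Context {R : realType} (omega : R) (aper : aperiodic omega).
Implicit Types (s t : R) (theta : S1 R) (x y : II R).

(** The fibre over [omega] is therefore a single point, which allows the band to have width 0 over
    the integers. *)
Lemma generic_omega : generic omega omega.
Proof.
move=> k; rewrite /orb -[X in X + _]mul1r -mulrDl nat1r; exact: aper.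
Qed.

Definition skew_fibre (p : Omega R) : II R :=
  clip (fibre_map omega (repr p.1) (II_val p.2)).

Definition skew (p : Omega R) : Omega R := (rotation omega p.1, skew_fibre p).

Lemma skew_fibre_pi t x : skew_fibre (S1_pi t, x) = clip (fibre_map omega t (II_val x)).
Proof. by rewrite /skew_fibre/= (fibre_map_congr _ _ (repr_S1_pi t)). Qed.

Lemma II_val_skew_fibre t x :
  II_val (skew_fibre (S1_pi t, x)) = fibre_map omega t (II_val x).
Proof. by rewrite skew_fibre_pi clipK// fibre_map_itv// II_val_itv. Qed.

Lemma skewE t x : skew (S1_pi t, x) = (S1_pi (t + omega), skew_fibre (S1_pi t, x)).
Proof. by rewrite /skew/= rotationE. Qed.

Lemma continuous_skew_fibre : continuous skew_fibre.
Proof.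
apply: (@continuous_S1_prod R (II R) (II R) skew_fibre) => p.
have -> : (fun q : R * II R => skew_fibre (S1_pi q.1, q.2)) =
    clip \o (fun q => fibre_map omega q.1 (II_val q.2)).
  by apply/funext => q; rewrite skew_fibre_pi.
apply: continuous_comp; last exact: continuous_clip.
apply: (@continuous_comp _ _ _ (fun q : R * II R => (q.1, II_val q.2))
  (fun q : R * R => fibre_map omega q.1 q.2)); last exact: continuous_fibre_map.
apply: continuous_pair; first exact: cvg_fst.
by apply: continuous_comp; [exact: cvg_snd|exact: continuous_II_val].
Qed.

Lemma skew_fibre_anti theta x y : II_val x <= II_val y ->
  II_val (skew_fibre (theta, y)) <= II_val (skew_fibre (theta, x)).
Proof.
move: theta; apply: S1_pi_ind => t xy.
by rewrite !II_val_skew_fibre; exact: fibre_map_anti.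
Qed.

Lemma skew_fibre_top theta : skew_fibre (theta, II_top R) = II_bot R.
Proof.
move: theta; apply: S1_pi_ind => t; apply: II_val_inj.
by rewrite II_val_skew_fibre; exact: fibre_map_top.
Qed.

Lemma skew_fibre_bot theta : skew_fibre (theta, II_bot R) = II_top R.
Proof.
move: theta; apply: S1_pi_ind => t; apply: II_val_inj.
by rewrite II_val_skew_fibre; exact: fibre_map_bot.
Qed.

(** The set A described fibrewise; [attractor_closure] identifies it with the closure of a graph.
    The choice of representatives is immaterial by [attractor_pi]. *)
Definition attractor : set (Omega R) := [set p | fibre omega (repr p.1) (II_val p.2)].

Lemma attractor_pi t x : attractor (S1_pi t, x) <-> fibre omega t (II_val x).
Proof.
have h := repr_S1_pi t; split; apply: fibre_congr => //.
by rewrite -opprB rpredN.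
Qed.

Lemma fibre_itv t (a : R) : fibre omega t a -> -2 <= a <= 2.
Proof. by move/norm_fibre_le1; rewrite ler_norml; lra. Qed.

Lemma attractor_clip t (a : R) : fibre omega t a -> attractor (S1_pi t, clip a).
Proof. by move=> fa; apply/attractor_pi; rewrite clipK// (fibre_itv fa). Qed.

(** A point of the closure is approached by points over nearby [s]; [fibre_usc] moves these into the
    fibre over [t], which is closed. *)
Lemma attractor_closed : closed attractor.
Proof.
move=> [+ x]; apply: S1_pi_ind => t cl; apply/attractor_pi.
apply: fibre_closed => e e0; have e2 : 0 < e / 2 by lra.
have tU : nbhs (S1_pi t) (@S1_pi R @` [set s | fibre_mod omega t (s - t) < e / 2]).
  by apply/nbhs_S1_pi; apply: filterS (fibre_mod_small omega t e2) => s hs; exists s.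
have xV : nbhs x [set y | `|II_val x - II_val y| < e / 2].
  by move/cvgrPdist_lt: (@continuous_II_val R x) => /(_ _ e2).
have [[theta y] [Ay [/= [s hs st] hy]]] :=
  cl _ (ex_intro2 _ _ (_, _) (conj tU xV) (@subset_refl _ _)).
rewrite -st in Ay; have [x' fx' hx'] := fibre_usc t ((attractor_pi s y).1 Ay).
exists x' => //; apply: le_trans (ler_distD (II_val y) _ _) _.
by rewrite /= in hs hy; lra.
Qed.

(** The map drops the first coordinate of a compatible sequence. It is onto because a coordinate can
    always be prepended, by [compatible_cons]. *)
Lemma skew_attractor : skew @` attractor = attractor.
Proof.
apply/seteqP; split => [_ [[+ x]] + <-|[+ x]]; apply: S1_pi_ind => t.
  move=> /attractor_pi [y cy xy]; rewrite skewE; apply/attractor_pi.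
  rewrite II_val_skew_fibre xy fibre_map_altsum//; last exact: generic_omega.
  by eexists; first exact: compatibleS.
rewrite -(subrK omega t); set s := t - omega => /attractor_pi [y cy xy].
have cz := compatible_cons cy; set z := fun k : nat => _ in cz.
have fz : fibre omega s (altsum z) by exists z.
exists (S1_pi s, clip (altsum z)); first exact: attractor_clip.
rewrite skewE; congr pair; apply: II_val_inj.
rewrite II_val_skew_fibre clipK ?(fibre_itv fz)//.
by rewrite fibre_map_altsum//; exact: generic_omega.
Qed.

Definition gen_set : set (S1 R) := [set theta | generic omega (repr theta)].

Definition gen_map theta : II R := clip (phi_lift omega (repr theta)).

Lemma orb_repr_S1_pi t (k : nat) :
  (orb omega (repr (S1_pi t)) k \is a Num.int) = (orb omega t k \is a Num.int).
Proof.
rewrite -(subrKC (orb omega t k) (orb omega (repr (S1_pi t)) k)) rpredDr//.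
by rewrite orbB repr_S1_pi.
Qed.

Lemma gen_set_pi t : gen_set (S1_pi t) <-> generic omega t.
Proof. by split=> gt k; have := gt k; rewrite orb_repr_S1_pi. Qed.

Lemma gen_map_pi t : gen_map (S1_pi t) = clip (phi_lift omega t).
Proof. by rewrite /gen_map (phi_lift_congr _ (repr_S1_pi t)). Qed.

(** The condition at each time [k] is open by continuity of [dist_int], and dense because generic
    points satisfy it. *)
Lemma residual_gen_set : residual gen_set.
Proof.
exists gen_set => //.
exists (fun k => [set theta | orb omega (repr theta) k \isn't a Num.int]); last first.
  by apply/seteqP; split=> [theta gt k _|theta gt k]; [exact: gt|exact: (gt k I)].
move=> k; split.
  rewrite openE; apply: S1_pi_ind => t /=; rewrite orb_repr_S1_pi => tk.
  rewrite /interior; apply/nbhs_S1_pi.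
  have ct : {for t, continuous (fun s => dist_int (orb omega s k))}.
    apply: continuous_comp; last exact: continuous_dist_int.
    by apply: cvgD; [exact: cvg_id|exact: cvg_cst].
  have d0 : 0 < dist_int (orb omega t k) by rewrite lt_def dist_int_eq0 tk dist_int_ge0.
  have /cvgrPdist_lt/(_ _ d0) := ct; apply: filterS => s /= st.
  rewrite orb_repr_S1_pi -dist_int_eq0; apply: contraTneq st => ->.
  by rewrite subr0 ger0_norm ?dist_int_ge0// ltxx.
move=> O [theta]; move: theta; apply: S1_pi_ind => t Ot oO.
have /nbhs_S1_pi/(generic_near aper)[s gs Os] : nbhs (S1_pi t) O by exact: open_nbhs_nbhs.
by exists (S1_pi s); split => //=; rewrite orb_repr_S1_pi; exact: gs.
Qed.

(** At a generic point the fibre is a singleton, so upper semicontinuity is continuity. *)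
Lemma continuous_gen_map : {within gen_set, continuous gen_map}.
Proof.
apply: continuous_in_subspaceT => + /set_mem; apply: S1_pi_ind => t /gen_set_pi gt.
apply: continuous_at_S1_pi.
have -> : (fun s => gen_map (S1_pi s)) = clip \o phi_lift omega.
  by apply/funext => s; rewrite gen_map_pi.
apply: continuous_comp; last exact: continuous_clip.
apply/cvgrPdist_lt => e e0; apply: filterS (fibre_mod_small omega t e0) => s.
have [x' fx'] := fibre_usc t (fibre_phi_lift omega s).
by rewrite (fibre_generic gt fx') distrC => /le_lt_trans; apply.
Qed.

Lemma attractor_closure : attractor = closure (graph_on gen_set gen_map).
Proof.
apply/seteqP; split; last first.
  rewrite [X in _ `<=` X]((closure_id _).1 attractor_closed).
  apply: closureS => -[+ x]; apply: S1_pi_ind => t [/= _ ->].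
  by rewrite gen_map_pi; apply: attractor_clip; exact: fibre_phi_lift.
move=> [+ x]; apply: S1_pi_ind => t /attractor_pi fx W [[U V] [/= tU xV] UVW].
have /nbhs_ballP[d /= d0 dU] := (nbhs_S1_pi t U).1 tU.
have [e e0 eV] := near_II xV.
have de : 0 < Num.min d e by rewrite lt_min d0.
have [s gs [st sx]] := fibre_approx aper fx de.
exists (S1_pi s, gen_map (S1_pi s)); split; first by split => //=; exact/gen_set_pi.
move: st sx; rewrite !lt_min => /andP[sd _] /andP[_ se].
apply: UVW; split; first by apply: dU; rewrite /ball/= distrC.
apply: eV; rewrite gen_map_pi clipK ?(fibre_itv (fibre_phi_lift _ _))//.
by rewrite distrC.
Qed.

(** A relatively clopen part [B] is a union of whole fibres, these being connected. Its projection
    to the line and that of its complement are closed, disjoint and cover the line, so [B] is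
    everything. *)
Lemma attractor_connected : connected attractor.
Proof.
move=> B [p0 Bp0] [C1 oC1 BC1] [C2 cC2 BC2].
pose P := [set t : R | exists x, (attractor `&` C2) (S1_pi t, x)].
pose Q := [set t : R | exists x, (attractor `&` ~` C1) (S1_pi t, x)].
have cP : closed P by apply: closed_proj; apply: closedI => //; exact: attractor_closed.
have cQ : closed Q.
  apply: closed_proj; apply: closedI; first exact: attractor_closed.
  exact: open_closedC.
have PQ : P = ~` Q.
  apply/seteqP; split => [t [x Px] [y [Ay C1y]]|t nQt]; last first.
    have At := attractor_clip (fibre_phi_lift omega t).
    exists (clip (phi_lift omega t)); rewrite -BC2 BC1; split => //.
    by apply: contrapT => C1t; apply: nQt; eexists; split; [exact: At|].
  pose j (a : R) : Omega R := (S1_pi t, clip a).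
  pose K := j @` fibre omega t.
  have KA : K `<=` attractor by move=> _ [a fa <-]; exact: attractor_clip.
  have cK : connected K.
    apply: connected_continuous_connected.
      by apply/connected_intervalP; exact: fibre_is_interval.
    apply: continuous_subspaceT => a; apply: (@continuous_pair _ _ _ (fun=> S1_pi t) clip).
      exact: cvg_cst.
    exact: continuous_clip.
  have Kx z : attractor (S1_pi t, z) -> K (S1_pi t, z).
    by move/attractor_pi => fz; exists (II_val z) => //; rewrite /j II_valK.
  have KB (C : set (Omega R)) : B = attractor `&` C -> K `&` B = K `&` C.
    by move=> ->; rewrite setIA (setIidl KA).
  have : K `&` B = K.
    apply: cK; last by exists C2 => //; exact: KB.
      by exists (S1_pi t, x); split; [apply: Kx; case: Px|rewrite BC2].
    by exists C1 => //; exact: KB.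
  by move/seteqP => [_ /(_ _ (Kx _ Ay)) [_]]; rewrite BC1 => -[].
have PT : P = setT.
  apply: (connected_intervalP [set: R]).2.
  - by move=> a b _ _ c _.
  - case: p0 Bp0 => + x; apply: S1_pi_ind => t Bt; exists t, x; by rewrite -BC2.
  - by exists P; rewrite ?setTI// PQ; exact: closed_openC.
  - by exists P; rewrite ?setTI.
apply/seteqP; split=> [q|[+ x]]; first by rewrite BC1 => -[].
apply: S1_pi_ind => t At; apply: contrapT => nB.
have : P t by rewrite PT.
rewrite PQ; apply; exists x; split => // C1t; apply: nB; by rewrite BC1.
Qed.

(** The arc passes over a singular [t] in its interior. Every point of the fibre over [t] is a limit
    of points over generic [s], where the arc must agree with phi; continuity then leaves a single
    point in that fibre, against [fibre_singular]. *)
Lemma attractor_no_arc (C : set (Omega R)) : arc_of_curve C -> ~ C `<=` attractor.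
Proof.
move=> [J [psi [[i [iI [a [b [ia ib ab]]] JE]] cpsi ->]]] sub.
have [t /andP[ta tb] [k tk]] := singular_dense aper ab.
pose I := [set s : R | a < s < b].
have oI : open I.
  by rewrite (_ : I = `]a, b[%classic) ?interval_open//; apply/seteqP; split => s;
    rewrite /= in_itv.
have IJ s : I s -> J (S1_pi s).
  move=> /andP[s1 s2]; rewrite JE; exists s => //.
  by apply: (iI a b) => //; rewrite !ltW.
have It : I t by rewrite /I/= ta tb.
(* Continuity within [J] is plain continuity here, because the image of [I] is open. *)
have cpsi' : {for S1_pi t, continuous psi}.
  have /continuous_subspaceW/(_ cpsi) : @S1_pi R @` I `<=` J by move=> _ [s /IJ Js <-].
  rewrite continuous_open_subspace; last exact: S1_pi_open.
  by apply; apply/mem_set; exists t.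
pose h s := II_val (psi (S1_pi s)).
have ch : {for t, continuous h}.
  apply: continuous_comp; last exact: continuous_II_val.
  by apply: continuous_comp => //; exact: continuous_S1_pi.
have hx (x' : R) : fibre omega t x' -> x' = h t.
  move=> fx'; apply/eqP; rewrite -subr_eq0 -normr_le0; apply/ler_addgt0Pr => e e0.
  rewrite add0r; have e2 : 0 < e / 2 by lra.
  have near_h : \forall s \near t, `|h t - h s| < e / 2.
    by have /cvgrPdist_lt/(_ _ e2) := ch.
  have /nbhs_ballP[d /= d0 dP] : \forall s \near t, I s /\ `|h t - h s| < e / 2.
    by apply: filterI => //; exact: open_nbhs_nbhs.
  have de : 0 < Num.min d (e / 2) by rewrite lt_min d0.
  have [s gs [st sx]] := fibre_approx aper fx' de.
  move: st sx; rewrite !lt_min => /andP[sd _] /andP[_ se].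
  have [|Is hs] := dP s; first by rewrite /ball/= distrC.
  have hsE : h s = phi_lift omega s.
    apply: (fibre_generic gs); apply/attractor_pi; apply: sub; split => //.
    exact: IJ.
  apply: le_trans (ler_distD (h s) _ _) _.
  by rewrite hsE in hs *; rewrite distrC in se; rewrite [`|_ - h t|]distrC; lra.
have [x' fx'] := fibre_singular tk.
by rewrite (hx _ fx') (hx _ (fibre_phi_lift omega t)) eqxx.
Qed.

Lemma skew_no_invariant_curve (C : set (Omega R)) : curve C -> ~ invariant_set skew C.
Proof.
move=> [gamma cg CE] inv.
have step theta : gamma (rotation omega theta) = skew_fibre (theta, gamma theta).
  have : C (skew (theta, gamma theta)).
    by apply: inv; exists (theta, gamma theta) => //; rewrite CE; split.
  by rewrite CE => -[_ /= ->].
have cgr : continuous (fun theta => (theta, gamma theta) : Omega R).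
  by move=> theta; apply: continuous_pair; [exact: cvg_id|exact: cg].
(* If the curve meets the set, it stays in it along the dense orbit of [theta0], hence everywhere by
   closedness. *)
have [[theta0 A0]|noA] := pselect (exists theta, attractor (theta, gamma theta)).
  have At j : attractor (iter j (rotation omega) theta0,
      gamma (iter j (rotation omega) theta0)).
    elim: j => [//|j IH]; rewrite iterS step.
    by rewrite -skew_attractor; exists (iter j (rotation omega) theta0,
      gamma (iter j (rotation omega) theta0)).
  have iterE t j : iter j (rotation omega) (S1_pi t) = S1_pi (orb omega t j).
    elim: j => [|j IH]; first by rewrite orb0.
    by rewrite iterS IH rotationE; congr S1_pi; rewrite /orb -natr1; ring.
  have cD : closed [set theta | attractor (theta, gamma theta)].
    apply: (@closed_comp _ _ (fun theta => (theta, gamma theta) : Omega R)) => //.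
    exact: attractor_closed.
  (* The whole curve counts as an arc, over the image of the real line. *)
  apply: (@attractor_no_arc C).
    exists setT, gamma; split => //; last exact: continuous_subspaceT.
    exists setT; split => //; first by exists 0, 1; rewrite ltr01.
    by apply/seteqP; split => // + _; apply: S1_pi_ind => t; exists t.
  move=> [theta x]; rewrite CE => -[_ /= ->].
  apply: cD => U; move: theta theta0 At A0.
  apply: S1_pi_ind => t; apply: S1_pi_ind => t0 At _.
  move=> /nbhs_S1_pi/nbhs_ballP[e /= e0 eU].
  have [|j j0 [m /andP[h1 h2]]] := @aperiodic_dense _ omega (t - e - t0) (t + e - t0) aper.
    by lra.
  exists (S1_pi (orb omega t0 j)); split.
    by rewrite -iterE; exact: At.
  have -> : S1_pi (orb omega t0 j) = S1_pi (orb omega t0 j + m%:~R).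
    by apply/S1_pi_eq; rewrite opprD addNKr rpredN intr_int.
  by apply: eU; rewrite /ball/= /orb ltr_norml; apply/andP; split; lra.
pose up := [set p : Omega R | II_val (gamma p.1) < II_val p.2].
pose up' := [set p : Omega R | II_val (gamma p.1) <= II_val p.2].
pose d (p : Omega R) := II_val p.2 - II_val (gamma p.1).
have cd : continuous d.
  move=> p; apply: cvgB.
    by apply: continuous_comp; [exact: cvg_snd|exact: continuous_II_val].
  apply: continuous_comp; last exact: continuous_II_val.
  by apply: continuous_comp; [exact: cvg_fst|exact: cg].
(* As the curve misses the set, strict and non-strict inequalities agree on it, so the part above
   the curve is relatively clopen. *)
have upE : attractor `&` up = attractor `&` up'.
  apply/seteqP; split => [[theta x] [Ap]|[theta x] [Ap]] /=.
    by move=> /ltW h; split.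
  rewrite /up' /= le_eqVlt => /predU1P[/II_val_inj gx|h]; last by split.
  by case: noA; exists theta; rewrite gx.
have oup : open up.
  rewrite (_ : up = d @^-1` [set r | 0 < r]).
    by apply: open_comp => [p _|]; [exact: cd|exact: open_gt].
  by apply/seteqP; split => p; rewrite /up /d /= subr_gt0.
have cup : closed up'.
  rewrite (_ : up' = d @^-1` [set r | 0 <= r]).
    by apply: closed_comp => [p _|]; [exact: cd|exact: closed_ge].
  by apply/seteqP; split => p; rewrite /up' /d /= subr_ge0.
have A0 : attractor (S1_pi 0, clip (phi_lift omega 0)).
  by apply: attractor_clip; exact: fibre_phi_lift.
have As p : attractor p -> attractor (skew p).
  by move=> Ap; rewrite -skew_attractor; exists p.
(* The set lies entirely above or entirely below the curve. Either way order reversal sends a point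
   of it weakly to the other side, although its image is in the set again. *)
have [[p [Ap upp]]|noup] := pselect (attractor `&` up !=set0).
  have /seteqP[_ allup] : attractor `&` up = attractor.
    by apply: attractor_connected; [exists p|exists up|exists up'].
  have [_] := allup _ (As _ Ap); rewrite /up/= step.
  case: p Ap upp => theta x Ap /= /ltW/skew_fibre_anti h.
  by rewrite /skew_fibre/= ltNge h.
have down theta x : attractor (theta, x) -> II_val x < II_val (gamma theta).
  by move=> Ap; rewrite ltNge; apply/negP => h; apply: noup; exists (theta, x);
    rewrite upE; split.
have /ltW/skew_fibre_anti h := down _ _ A0.
have := down _ _ (As _ A0); rewrite step.
by rewrite ltNge h.
Qed.

End SkewProduct.

(** * The boundary circles, and the assembly of the theorem *)

Lemma circle_curve {R : realType} (x : II R) : curve [set p : Omega R | p.2 = x].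
Proof.
exists (fun=> x); first by move=> theta; exact: cst_continuous.
by apply/seteqP; split => p //= [].
Qed.

Lemma skew_image_circle {R : realType} (omega : R) (x y : II R) :
    (forall theta, skew_fibre omega (theta, x) = y) ->
  skew omega @` [set p | p.2 = x] = [set p | p.2 = y].
Proof.
move=> xy; apply/seteqP; split => [_ [[theta z] /= -> <-]|[+ z]]; first exact: xy.
apply: S1_pi_ind => t /= ->; exists (S1_pi (t - omega), x) => //.
by rewrite skewE subrK xy.
Qed.

Theorem theorem7p5 (R : realType) (omega : R) (omega01 : 0 <= omega <= 1)
    (omega_irr : @irrational R omega) :
  exists (T : Omega R -> Omega R) (f : Omega R -> II R),
    S_class omega T /\
    (forall theta x, T (theta, x) = (rotation omega theta, f (theta, x))) /\
    (forall theta (x y : II R), II_val x <= II_val y ->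
       II_val (f (theta, y)) <= II_val (f (theta, x))) /\
    (forall theta, f (theta, II_top R) = II_bot R /\
                   f (theta, II_bot R) = II_top R) /\
    period_two_curves T (@upper_circle R) (@lower_circle R) /\
    (exists A : set (Omega R),
       [/\ pseudo_curve A, connected A,
           ~ (exists C : set (Omega R), arc_of_curve C /\ C `<=` A)
         & T @` A = A]) /\
    ~ (exists C : set (Omega R), curve C /\ invariant_set T C).
Proof.
have ap := irrational_aperiodic omega_irr.
have top_bot := @skew_image_circle R omega _ _ (@skew_fibre_top R omega).
have bot_top := @skew_image_circle R omega _ _ (@skew_fibre_bot R omega).
exists (skew omega), (skew_fibre omega); split.
  by exists (skew_fibre omega) => //; exact: continuous_skew_fibre.
split; first by [].
split; first by move=> theta x y; exact: skew_fibre_anti.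
split; first by move=> theta; rewrite skew_fibre_top skew_fibre_bot.
split.
  split; [exact: circle_curve|exact: circle_curve| |exact: top_bot|exact: bot_top].
  move=> /seteqP[/(_ (S1_pi 0, II_top R) erefl)/(congr1 (@II_val R))].
  by rewrite /II_val/=; lra.
split; last by move=> [C [cC]]; exact: skew_no_invariant_curve.
exists (attractor omega); split.
- exists (gen_set omega), (gen_map omega); split; last exact: attractor_closure.
    exact: residual_gen_set.
  exact: continuous_gen_map.
- exact: attractor_connected.
- by move=> [C [aC]]; exact: attractor_no_arc aC.
- exact: skew_attractor.
Qed.
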